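(* The crystallographic representations of the icosahedral group $\mathcal{I}$ in $B_6$, i.e. the subgroups $\mathcal{H}$ of $B_6$ that are isomorphic to $\mathcal{I}$ and satisfy $\mathcal{H} \simeq T_1 \oplus T_2$ in $GL(6,\mathbb{R})$, form a single conjugacy class of subgroups of $B_6$, and this class has exactly $192$ elements (subgroups).
   Context: $B_6 = O(6)\cap GL(6,\mathbb{Z})$ is the hyperoctahedral group in dimension $6$, i.e. the group of all $6\times 6$ signed permutation matrices (order $2^6\, 6! = 46080$). $\mathcal{I}$ is the (rotational) icosahedral group of order $60$, isomorphic to the alternating group $A_5$. Its irreducible representations are $A, T_1, T_2, G, H$ of dimensions $1,3,3,4,5$; $T_1$ and $T_2$ are the two inequivalent $3$-dimensional (real) irreducible representations. A subgroup $\mathcal{H}\le B_6$ isomorphic to $\mathcal{I}$ is called an (orthogonal) crystallographic representation of $\mathcal{I}$ if its natural action on $\mathbb{R}^6$ is equivalent, in $GL(6,\mathbb{R})$, to $T_1\oplus T_2$. The conjugacy class of a subgroup $H$ in a group $G$ is $\{gHg^{-1}: g\in G\}$. *)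

(* Defs.v *)
From HB Require Import structures.
From mathcomp Require Import all_boot all_order all_algebra all_fingroup.
From mathcomp Require Import all_solvable all_character.
From mathcomp Require Import reals.

Set Implicit Arguments.
Unset Strict Implicit.
Unset Printing Implicit Defensive.

Import Order.TTheory GRing.Theory Num.Theory.
Local Open Scope ring_scope.

(* GL(6, Z) is membership in [unitmx], O(6) is [A *m A^T = 1]. *)
Definition hyperoct_pred : pred 'M[int]_6 :=
  fun A => (A \in unitmx) && (A *m A^T == 1%:M).

Record B6 : predArgType := MkB6 { B6val :> 'M[int]_6; _ : hyperoct_pred B6val }.

HB.instance Definition _ := [isSub for B6val].
HB.instance Definition _ := [Countable of B6 by <:].

Lemma B6_mulT (A : B6) : B6val A *m (B6val A)^T = 1%:M.
Proof. by case: A => A /= /andP[_ /eqP]. Qed.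

Lemma B6_Tmul (A : B6) : (B6val A)^T *m B6val A = 1%:M.
Proof. exact: mulmx1C (B6_mulT A). Qed.

Lemma B6_entry (A : B6) i j : (`|B6val A i j| < 2)%N.
Proof.
have /matrixP/(_ i i) := B6_mulT A.
rewrite !mxE eqxx (bigD1 j) //= !mxE => sum1.
have sq_le1 : B6val A i j ^+ 2 <= 1.
  rewrite -[X in _ <= X]sum1 expr2 lerDl sumr_ge0 // => k _.
  by rewrite !mxE -expr2 sqr_ge0.
have : (`|B6val A i j|%N%:Z) ^+ 2 <= 1 by rewrite abszE real_normK ?num_real.
by case: (`|_|%N) => [|[|n]].
Qed.

(* Finiteness: an entry lies in {-1, 0, 1}, hence is determined by its absolute
   value in 'I_2 together with its sign. *)
Definition B6_code (A : B6) : 'M[('I_2 * bool)%type]_6 :=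
  \matrix_(i, j) (Ordinal (B6_entry A i j), B6val A i j < 0).

Definition B6_decode (M : 'M[('I_2 * bool)%type]_6) : option B6 :=
  insub (\matrix_(i, j) ((-1) ^+ (M i j).2 * ((M i j).1 : nat)%:Z)).

Lemma B6_codeK : pcancel B6_code B6_decode.
Proof.
move=> A; rewrite /B6_decode.
have -> : (\matrix_(i, j) ((-1) ^+ (B6_code A i j).2
             * ((B6_code A i j).1 : nat)%:Z)) = B6val A.
  by apply/matrixP=> i j; rewrite !mxE /= abszE -realEsign ?num_real.
exact: valK.
Qed.

HB.instance Definition _ : isFinite B6 := PCanIsFinite B6_codeK.

Lemma hyperoct_pred1 : hyperoct_pred 1%:M.
Proof. by rewrite /hyperoct_pred unitmx1 trmx1 mulmx1 eqxx. Qed.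

Lemma hyperoct_predM (A B : B6) : hyperoct_pred (B6val A *m B6val B).
Proof.
case: A B => A /= /andP[uA /eqP oA] [B /= /andP[uB /eqP oB]].
apply/andP; split; first by rewrite unitmx_mul uA uB.
by rewrite trmx_mul mulmxA -(mulmxA A) oB mulmx1 oA.
Qed.

Lemma hyperoct_predV (A : B6) : hyperoct_pred (B6val A)^T.
Proof.
apply/andP; split; last by rewrite trmxK B6_Tmul.
by rewrite unitmx_tr; case: A => A /= /andP[].
Qed.

Definition B6_one : B6 := MkB6 hyperoct_pred1.
Definition B6_mul (A B : B6) : B6 := MkB6 (hyperoct_predM A B).
Definition B6_inv (A : B6) : B6 := MkB6 (hyperoct_predV A).

Lemma B6_mulA : associative B6_mul.
Proof. by move=> A B C; apply: val_inj; rewrite /= mulmxA. Qed.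
Lemma B6_mul1 : left_id B6_one B6_mul.
Proof. by move=> A; apply: val_inj; rewrite /= mul1mx. Qed.
Lemma B6_mulV : left_inverse B6_one B6_inv B6_mul.
Proof. by move=> A; apply: val_inj; rewrite /= B6_Tmul. Qed.

HB.instance Definition _ := Finite_isGroup.Build B6 B6_mulA B6_mul1 B6_mulV.

(* The icosahedral group as an abstract group. *)
Definition Ico : {group {perm 'I_5}} := ('Alt_('I_5))%G.

Section Crystallographic.

Variable R : realType.

Lemma B6_pullback_mx_repr (f : {morphism Ico >-> B6}) :
  mx_repr Ico (fun g => map_mx intr (B6val (f g)) : 'M[R]_6).
Proof.
split=> [|x y Ix Iy]; first by rewrite morph1 map_mx1.
by rewrite morphM //= map_mxM.
Qed.

(* The representation of Ico on R^6 given by a morphism f to B6, i.e. the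
   natural action of the image of f. *)
Definition B6_pullback (f : {morphism Ico >-> B6}) : mx_representation R Ico 6 :=
  MxRepresentation (B6_pullback_mx_repr f).

(* Ico has exactly two real irreducible representations of dimension 3 up to
   equivalence, so this determines {T1, T2}; their order is immaterial below. *)
Definition T1T2_pair (T1 T2 : mx_representation R Ico 3) : Prop :=
  [/\ mx_irreducible T1, mx_irreducible T2 & ~ mx_rsim T1 T2].

Definition crystallographic (H : {group B6}) : Prop :=
  exists f : {morphism Ico >-> B6}, isom Ico H f /\
  exists T1 T2 : mx_representation R Ico 3, T1T2_pair T1 T2 /\
    mx_rsim (B6_pullback f)
            (dadd_grepr (Representation T1) (Representation T2)).

End Crystallographic.

(* Main.v *)
Require Import Defs.
From mathcomp Require Import all_boot all_order all_algebra all_fingroup.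
From mathcomp Require Import all_solvable all_character.
From mathcomp Require Import reals zify.

Set Implicit Arguments.
Unset Strict Implicit.
Unset Printing Implicit Defensive.

Import Order.TTheory GRing.Theory Num.Theory.
Import GroupScope.

(** Write axis for a signed basis vector of R^6, encoded as an index and a sign.
    The hyperoctahedral group is the group of those permutations of the twelve
    axes that commute with [opp_axis]; every argument about subgroups of [B6]
    below is an argument about this action.

    One class.  Let [f] embed the icosahedral group in [B6] with R^6 equivalent
    to T1 + T2.  Neither summand has a nonzero fixed vector, so the sum of the
    orbit of an axis [p] is zero, and this forces [- p] into the orbit of [p]
    ([crystallographic_antipodal]).  Let P be a Sylow 5-subgroup of A5.  Counting
    fixed points modulo 5, P fixes exactly two axes [x] and [- x], and the orbit
    of [x], which contains both, has 2 or 12 elements.  It is not 2, because A5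
    has no subgroup of index 2.  So the axes are the cosets of P, and the
    antipode is the only nontrivial automorphism of this A5-set.  Nothing is left
    to choose: two such embeddings have isomorphic sets of axes, with antipodes,
    and such an isomorphism is an element of [B6].  Hence any two embeddings are
    conjugate, even as morphisms ([antipodal_conj]).

    Counting.  The class has [46080 / #|N|] members, where N is the normaliser of
    one of them.  N is transitive on the axes.  The stabiliser of [x] in N acts
    on P, which is cyclic of order 5, and the kernel of this action is P; all
    four automorphisms of P occur, because the uniqueness above, applied to [f]
    twisted by an odd permutation, turns that twist into conjugation by an
    element of N ([exists_outer]).  So [#|N| = 12 * 20].

    Existence.  One conjugacy class of 5-cycles of A5 has twelve elements and is
    closed under inversion; letting A5 act on it by conjugation, with inversion
    as antipode, gives an embedding in [B6].  A symmetric conference matrix J,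
    with [J ^ 2 = 5], commutes with it, and the commutant is spanned by 1 and J.
    The eigenspaces of J for the square roots of 5 have dimension 3, because J
    has trace zero; by Maschke's theorem they are irreducible, and they are not
    equivalent ([involution_splits]). *)

(** * Signed axes *)

Local Open Scope ring_scope.

Local Notation axis := ('I_6 * bool)%type.

Definition vec (p : axis) : 'rV[int]_6 := (-1) ^+ p.2 *: delta_mx 0 p.1.
Definition opp_axis (p : axis) : axis := (p.1, ~~ p.2).

Lemma opp_axisK : involutive opp_axis.
Proof. by case=> i b; rewrite /opp_axis /= negbK. Qed.

Lemma opp_axis_neq p : opp_axis p != p.
Proof. by case: p => i [] ; apply/eqP => [[]]. Qed.

Lemma vecE p j : vec p 0 j = (-1) ^+ p.2 * (p.1 == j)%:R.
Proof. by rewrite !mxE eqxx eq_sym. Qed.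

Lemma vec_opp p : vec (opp_axis p) = - vec p.
Proof. by rewrite /vec /= signrN scaleNr. Qed.

Lemma vec_inj : injective vec.
Proof.
case=> i b [j d] /rowP/(_ i); rewrite !vecE /= eqxx mulr1.
by case: eqP => [->|_]; case: b; case: d.
Qed.

Lemma vec_dot p q :
  (vec p *m (vec q)^T) 0 0 = (-1) ^+ (p.2 (+) q.2) * (p.1 == q.1)%:R.
Proof.
rewrite mxE (bigD1 p.1) //= [_^T _ _]mxE !vecE eqxx mulr1 big1 => [|k /negPf nk].
  by rewrite addr0 signr_addb mulrA [q.1 == _]eq_sym.
by rewrite vecE eq_sym nk mulr0 mul0r.
Qed.

(** The squares of the entries of an integer row of norm 1 are nonnegative
    integers with sum 1, so exactly one entry is nonzero, and it is a sign. *)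
Lemma B6_row (p : axis) (A : B6) : exists q, vec q == vec p *m B6val A.
Proof.
have norm1: ((vec p *m B6val A) *m (vec p *m B6val A)^T) 0 0 = 1.
  by rewrite trmx_mul mulmxA -(mulmxA (vec p)) B6_mulT mulmx1 vec_dot eqxx addbb.
set v := vec p *m B6val A in norm1 *; clearbody v.
have{norm1} sumv: \sum_j v 0 j ^+ 2 = 1.
  by rewrite -[RHS]norm1 mxE; apply: eq_bigr => j _; rewrite mxE expr2.
have [j vj]: exists j, v 0 j != 0.
  apply/existsP; apply: contraPT sumv; rewrite negb_exists => /forallP v0.
  by rewrite big1 // => j _; have /negPn/eqP-> := v0 j; rewrite expr0n.
have sq_ge1 k : v 0 k != 0 -> 1 <= v 0 k ^+ 2.
  by rewrite -sqrf_eq0 => vk; rewrite -gtz0_ge1 lt0r vk sqr_ge0.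
have rest0: \sum_(k | k != j) v 0 k ^+ 2 = 0.
  apply/eqP; rewrite eq_le sumr_ge0 ?andbT => [|k _]; last exact: sqr_ge0.
  rewrite -(lerD2l 1) addr0 -[X in _ <= X]sumv [X in _ <= X](bigD1 j) //=.
  by rewrite lerD2r sq_ge1.
have vk0 k : k != j -> v 0 k = 0.
  move=> nkj; apply/eqP; rewrite -sqrf_eq0.
  by rewrite (psumr_eq0P _ rest0) // => i _; apply: sqr_ge0.
have: v 0 j ^+ 2 == 1 by rewrite -[X in _ == X]sumv (bigD1 j) //= rest0 addr0.
rewrite sqrf_eq1 => vj1; exists (j, v 0 j == -1); apply/eqP/rowP=> k.
rewrite vecE /=; have [<-|nkj] := eqVneq j k; last by rewrite mulr0 vk0 // eq_sym.
by case/orP: vj1 => /eqP->; rewrite ?mulr1.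
Qed.

Definition axact (p : axis) (A : B6) : axis := xchoose (B6_row p A).

Lemma vec_axact p A : vec (axact p A) = vec p *m B6val A.
Proof. exact/eqP/(xchooseP (B6_row p A)). Qed.

Lemma axact1 p : axact p 1%g = p.
Proof. by apply: vec_inj; rewrite vec_axact mulmx1. Qed.

Lemma axactM p A B : axact p (A * B)%g = axact (axact p A) B.
Proof. by apply: vec_inj; rewrite !vec_axact -mulmxA. Qed.

Canonical axact_action := TotalAction axact1 axactM.

Lemma axact_opp p A : axact (opp_axis p) A = opp_axis (axact p A).
Proof. by apply: vec_inj; rewrite vec_axact !vec_opp vec_axact mulNmx. Qed.

Lemma axact_inj A : injective (axact^~ A).
Proof. exact: (act_inj axact_action). Qed.

Lemma axactK A : cancel (axact^~ A) (axact^~ A^-1%g).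
Proof. exact: (actK axact_action). Qed.

Lemma axactKV A : cancel (axact^~ A^-1%g) (axact^~ A).
Proof. exact: (actKV axact_action). Qed.

Lemma axact_faithful A B : axact^~ A =1 axact^~ B -> A = B.
Proof.
move=> eqAB; apply/val_inj/row_matrixP => i /=.
have rowE (C : B6) : row i (B6val C) = vec (axact (i, false) C).
  by rewrite vec_axact /vec /= scale1r -rowE.
by rewrite !rowE eqAB.
Qed.

(** Two axes are equal or opposite as soon as they lie on the same line; this is
    what makes an injective map commuting with the antipode act on lines. *)
Lemma axis_line_eq (p q : axis) : p.1 = q.1 -> p = q \/ p = opp_axis q.
Proof.
by case: p q => i b [j d] /= ->; case: b; case: d; [left|right|right|left].
Qed.

Lemma line_inj (phi : axis -> axis) :
    injective phi -> (forall p, phi (opp_axis p) = opp_axis (phi p)) ->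
  injective (fun i => (phi (i, false)).1).
Proof.
move=> phi_inj phi_opp i j /axis_line_eq[/phi_inj[] //|].
by rewrite -phi_opp => /phi_inj[].
Qed.

Section OfAxisMap.

Variable phi : axis -> axis.
Hypotheses (phi_inj : injective phi)
  (phi_opp : forall p, phi (opp_axis p) = opp_axis (phi p)).

Definition axis_mx : 'M[int]_6 := \matrix_i vec (phi (i, false)).

Lemma axis_mx_hyperoct : hyperoct_pred axis_mx.
Proof.
have orth: axis_mx *m axis_mx^T = 1%:M.
  apply/matrixP=> i j.
  transitivity ((vec (phi (i, false)) *m (vec (phi (j, false)))^T) 0 0).
    by rewrite !mxE; apply: eq_bigr => k _; rewrite !mxE.
  rewrite vec_dot mxE; have [<-|nij] := eqVneq i j; first by rewrite eqxx addbb.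
  suff /negPf->: (phi (i, false)).1 != (phi (j, false)).1 by rewrite mulr0.
  by apply: contraNneq nij => /(line_inj phi_inj phi_opp)->.
by rewrite /hyperoct_pred orth eqxx andbT; case: (mulmx1_unit orth).
Qed.

Definition axis_B6 : B6 := MkB6 axis_mx_hyperoct.

Lemma axact_axis_B6 p : axact p axis_B6 = phi p.
Proof.
have base i : axact (i, false) axis_B6 = phi (i, false).
  by apply: vec_inj; rewrite vec_axact /vec /= scale1r -rowE rowK.
case: p => i []; last exact: base.
by have := axact_opp (i, false) axis_B6; rewrite base -phi_opp.
Qed.

End OfAxisMap.

(** The converse of the description of [B6] by its action on axes: this is how
    all elements of [B6] are produced below. *)
Lemma exists_B6 (phi : axis -> axis) :
  injective phi -> (forall p, phi (opp_axis p) = opp_axis (phi p)) ->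
  exists A : B6, axact^~ A =1 phi.
Proof. by move=> i o; exists (axis_B6 i o) => p; apply: axact_axis_B6. Qed.

Lemma card_B6 : #|[set: B6]| = (2 ^ 6 * 6`!)%N.
Proof.
pose line A (i : 'I_6) := (axact (i, false) A).1.
have inj_line A : injective (line A) := line_inj (@axact_inj A) (axact_opp^~ A).
pose enc A := ([ffun i => (axact (i, false) A).2], perm (@inj_line A)).
pose of_pair (es : {ffun 'I_6 -> bool} * 'S_6) (p : axis) : axis :=
  (es.2 p.1, es.1 p.1 (+) p.2).
have of_inj es : injective (of_pair es).
  by case=> i b [j d] [/perm_inj<- /addbI->].
have of_opp es p : of_pair es (opp_axis p) = opp_axis (of_pair es p).
  by rewrite /of_pair /opp_axis /= addbN.
pose dec es := axis_B6 (of_inj es) (of_opp es).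
have encK : cancel enc dec.
  move=> A; apply: axact_faithful => -[i b].
  rewrite axact_axis_B6 /of_pair /= permE ffunE /line.
  have -> : (i, b) = if b then opp_axis (i, false) else (i, false) by case: b.
  by case: b => /=; rewrite ?axact_opp /opp_axis; case: (axact _ A) => j d;
    rewrite /= ?addbT ?addbF.
have decK : cancel dec enc.
  case=> e s; congr (_, _).
    by apply/ffunP=> i; rewrite ffunE axact_axis_B6 /= addbF.
  by apply/permP=> i; rewrite permE /line axact_axis_B6.
rewrite cardsT (bij_eq_card (Bijective encK decK)) card_prod card_ffun card_bool.
by rewrite card_ord card_Sn.
Qed.

(** * Antipodal embeddings of the icosahedral group *)

Local Close Scope ring_scope.
Local Open Scope group_scope.

Lemma card_Ico : #|Ico| = 60%N.
Proof.
have := @card_Alt 'I_5; rewrite card_ord => /(_ isT).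
by rewrite -[5`!]/(2 * 60)%N => /eqP; rewrite eqn_pmul2l // => /eqP.
Qed.

Lemma simple_Ico : simple Ico.
Proof. by apply: simple_Alt5; rewrite card_ord. Qed.

Lemma simple_index2 (gT : finGroupType) (G H : {group gT}) :
  simple G -> H \subset G -> #|G : H| = 2%N -> #|G| = 2%N.
Proof.
move=> /simpleP[_ simG] sHG iHG; have := Lagrange sHG; rewrite iHG.
case: (simG H (index2_normal sHG iHG)) => eqH; first by rewrite eqH cards1 => <-.
by move: iHG; rewrite eqH indexgg.
Qed.

Lemma orbit_size_cases o s :
  (o * (s * 5) = 60 -> o = 2 %[mod 5] -> o <= 12 -> o = 2 \/ o = 12)%N.
Proof.
move=> os60 mod5 le12; have {mod5 le12} : (o \in [:: 2; 7; 12])%N.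
  by move: mod5 le12 {os60}; do 13?[case: o => [|o] //].
by rewrite !inE => /or3P[] /eqP eo; [left | lia | right].
Qed.

(** The only consequence of being equivalent to T1 + T2 that matters for
    conjugacy.  It excludes the two other kinds of embedding, the permutation
    representations 1 + 1 + G and 1 + H. *)
Definition antipodal (f : {morphism Ico >-> B6}) : Prop :=
  'injm f /\ forall p, exists2 g, g \in Ico & axact p (f g) = opp_axis p.

Section Antipodal.

Variables (f : {morphism Ico >-> B6}) (P : {group {perm 'I_5}}).
Hypotheses (anti_f : antipodal f) (sylP : 5.-Sylow(Ico) P).

Definition fixed_axis (p : axis) := p \in 'Fix_axact_action(f @* P).

Let injf : 'injm f. Proof. by case: anti_f. Qed.
Let sPI : P \subset Ico. Proof. exact: pHall_sub sylP. Qed.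

Lemma card_Syl5 : #|P| = 5%N.
Proof. by rewrite (card_Hall sylP) card_Ico p_part. Qed.

Lemma fixed_axisP p :
  reflect (forall g, g \in P -> axact p (f g) = p) (fixed_axis p).
Proof.
apply: (iffP afixP) => [fixp g Pg | fixp _ /morphimP[g _ Pg ->]]; last exact: fixp.
by apply: fixp; rewrite mem_morphim ?(subsetP sPI).
Qed.

Lemma fixed_axis_opp p : fixed_axis (opp_axis p) = fixed_axis p.
Proof.
suff imp q : fixed_axis q -> fixed_axis (opp_axis q).
  by apply/idP/idP => /imp; rewrite ?opp_axisK.
by move/fixed_axisP=> fixq; apply/fixed_axisP=> g Pg; rewrite axact_opp fixq.
Qed.

Let fP5 : 5.-group (f @* P).
Proof. by rewrite morphim_pgroup ?(pHall_pgroup sylP). Qed.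

(** The axes fixed by P come in antipodal pairs and number 12 modulo 5, hence 2
    or 12; twelve is impossible because the action is faithful. *)
Lemma fixed_line : exists i, forall p, fixed_axis p = (p.1 == i).
Proof.
pose I := [set i : 'I_6 | fixed_axis (i, false)].
have fixI p : fixed_axis p = (p.1 \in I).
  case: p => i []; rewrite inE //=.
  by rewrite -[RHS]fixed_axis_opp.
have cardI : #|'Fix_([set: axis] | axact_action)(f @* P)| = (#|I| * 2)%N.
  transitivity #|setX I [set: bool]|; last by rewrite cardsX cardsT card_bool.
  apply: eq_card => -[j b]; rewrite in_setX in_setI !in_setT andbT /=.
  exact: (fixI (j, b)).
have mod5 : (#|I| * 2 = 12 %[mod 5])%N.
  rewrite -cardI -(pgroup_fix_mod fP5) ?cardsT ?card_prod ?card_ord ?card_bool //.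
  by apply/subsetP=> a _; rewrite !inE; apply/subsetP=> p; rewrite !inE.
have leI : (#|I| <= 6)%N by rewrite (leq_trans (max_card _)) ?card_ord.
have [all_fixed | notall] := eqVneq #|I| 6.
  have IT : I = [set: 'I_6].
    by apply/eqP; rewrite eqEcard subsetT cardsT card_ord all_fixed.
  suff: #|P| = 1%N by rewrite card_Syl5.
  rewrite -(card_injm injf) //; apply/eqP; rewrite -trivg_card1 -subG1.
  apply/subsetP=> _ /morphimP[g _ Pg ->]; rewrite inE; apply/eqP.
  apply: axact_faithful => p; rewrite axact1.
  by have /fixed_axisP-> : fixed_axis p by rewrite fixI IT inE.
have /eqP/cards1P[i defI] : #|I| = 1%N by move: mod5 leI notall; lia.
by exists i => p; rewrite fixI defI inE.
Qed.

Lemma exists_fixed_axis : exists p, fixed_axis p.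
Proof. by have [i fixi] := fixed_line; exists (i, false); rewrite fixi /=. Qed.

Variable x : axis.
Hypothesis fix_x : fixed_axis x.

Lemma fixed_axisE p : fixed_axis p = (p == x) || (p == opp_axis x).
Proof.
have [i fixi] := fixed_line; move: fix_x; rewrite !fixi => /eqP <-.
case: p x => j b [k d] /=; rewrite /opp_axis !xpair_eqE /=.
by case: (j == k); case: b; case: d.
Qed.

Let H := (f @* Ico)%G.
Let S := 'C_H[x | axact_action]%G.
Let O := orbit axact_action H x.

Let cardH : #|H| = 60%N.
Proof. by rewrite /= card_injm // card_Ico. Qed.

Let sQS : f @* P \subset S.
Proof.
rewrite subsetI morphimS //=; apply/subsetP=> _ /morphimP[g _ Pg ->].
by apply/astab1P; exact: (fixed_axisP _ fix_x).
Qed.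

(** Both fixed axes of P lie in the orbit of [x], so its size is 2 modulo 5 and,
    dividing 60 / 5, it is 2 or 12; an orbit of size 2 would give the simple
    group [f @* Ico] a subgroup of index 2. *)
Let cardO : #|O| = 12%N.
Proof.
have mul60 : (#|O| * #|S|)%N = 60%N by rewrite card_orbit_stab.
have dvd5 : (5 %| #|S|)%N by rewrite -card_Syl5 -(card_injm injf) // cardSg.
have fixO : 'Fix_(O | axact_action)(f @* P) = [set x; opp_axis x].
  apply/setP=> p; rewrite in_setI -/(fixed_axis p) fixed_axisE !inE andbC.
  case: orP => // -[] /eqP->; rewrite ?orbit_refl //=.
  have [_ /(_ x)[g Ig <-]] := anti_f; apply/orbitP; exists (f g) => //.
  exact: mem_morphim.
have mod5 : (#|O| = 2 %[mod 5])%N.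
  rewrite (pgroup_fix_mod (to := axact_action) (S := O) fP5) ?fixO ?cards2; last first.
    by rewrite (subset_trans (morphimS f sPI)) // acts_orbit ?subsetT.
  by rewrite eq_sym opp_axis_neq.
have le12 : (#|O| <= 12)%N.
  by rewrite (leq_trans (max_card _)) // card_prod card_ord card_bool.
case/dvdnP: dvd5 mul60 => s -> mul60.
case: (orbit_size_cases mul60 mod5 le12) => // O2.
suff: #|H| = 2%N by rewrite cardH.
apply: (@simple_index2 _ _ S); rewrite ?subsetIl -?card_orbit //.
by rewrite -(isog_simple (sub_isog (subxx _) injf)) // simple_Ico.
Qed.

Lemma axact_transitive p : exists2 g, g \in Ico & axact x (f g) = p.
Proof.
have : p \in O.
  suff -> : O = setT by rewrite inE.
  by apply/eqP; rewrite eqEcard subsetT cardO cardsT card_prod card_ord card_bool.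
by case/orbitP=> _ /morphimP[g _ Ig ->] <-; exists g.
Qed.

Lemma axact_stab g : g \in Ico -> (axact x (f g) == x) = (g \in P).
Proof.
move=> Ig; have eqS : f @* P = S.
  apply/eqP; rewrite eqEcard sQS /=.
  have := card_orbit_stab axact_action H x; rewrite cardO cardH => mul60.
  by rewrite card_injm // card_Syl5 -(@leq_pmul2l 12) // mul60.
have -> : (g \in P) = (f g \in f @* P).
  apply/idP/idP => [|/morphimP[h Ih Ph /(injmP injf)-> //]].
  exact: mem_morphim.
by rewrite eqS !inE mem_morphim //= sub1set inE.
Qed.

Lemma axact_eq g h : g \in Ico -> h \in Ico ->
  (axact x (f g) == axact x (f h)) = (g * h^-1 \in P).
Proof.
move=> Ig Ih; rewrite -axact_stab ?groupM ?groupV // morphM ?groupV // morphV //.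
by rewrite axactM -(inj_eq (@axact_inj (f h)^-1)) axactK.
Qed.

End Antipodal.

(** The map sending [x * f g] to [x' * f' g] is well defined because both
    stabilisers are P.  It commutes with the antipode: if [s] carries [x] to
    [- x] through [f], then [s] normalises P, so through [f'] it carries [x'] to
    a P-fixed axis other than [x'], which is [- x']. *)
Lemma antipodal_conj (f f' : {morphism Ico >-> B6}) (P : {group {perm 'I_5}}) x x' :
    antipodal f -> antipodal f' -> 5.-Sylow(Ico) P ->
    fixed_axis f P x -> fixed_axis f' P x' ->
  exists2 A, axact x A = x' & {in Ico, forall g, f' g = f g ^ A}.
Proof.
move=> anti anti' sylP fx fx'.
have eqf := axact_eq anti sylP fx; have eqf' := axact_eq anti' sylP fx'.
have sPI := subsetP (pHall_sub sylP).
have [h hI hE] := fin_all_exists2 (axact_transitive anti sylP fx).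
pose phi p := axact x' (f' (h p)).
have phiE g : g \in Ico -> phi (axact x (f g)) = axact x' (f' g).
  by move=> Ig; apply/eqP; rewrite eqf' // -eqf // hE.
have phi_inj : injective phi.
  by move=> p q /eqP; rewrite eqf' // -eqf // !hE => /eqP.
have [s Is xs] := axact_transitive anti sylP fx (opp_axis x).
have x's : axact x' (f' s) = opp_axis x'.
  have : fixed_axis f' P (axact x' (f' s)).
    apply/(fixed_axisP f' sylP) => g Pg; have Ig := sPI g Pg.
    have Isg := groupM Is Ig.
    apply/eqP; rewrite -axactM -morphM // eqf' // -eqf //.
    rewrite morphM // axactM xs; apply/eqP.
    by rewrite axact_opp (fixed_axisP f sylP _ fx).
  rewrite (fixed_axisE anti' sylP fx') (axact_stab anti' sylP fx') //.
  rewrite -(axact_stab anti sylP fx) // xs (negPf (opp_axis_neq _)).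
  by move/eqP.
have phi_opp p : phi (opp_axis p) = opp_axis (phi p).
  rewrite -(hE p) phiE // -axact_opp -xs -axactM -morphM // phiE ?groupM //.
  by rewrite morphM // axactM x's axact_opp.
have [A AE] := exists_B6 phi_inj phi_opp; exists A => [|g Ig].
  by rewrite AE -{1}(axact1 x) -(morph1 f) phiE // morph1 axact1.
suff fA : f g * A = A * f' g by rewrite conjgE fA mulKg.
apply: axact_faithful => p; rewrite !axactM !AE -(hE p) -axactM -morphM //.
by rewrite !phiE ?groupM // morphM // axactM.
Qed.

(** * Computing with permutations of five points *)

(** Permutations of ['I_5] do not reduce; those needed are therefore given by the
    list of their values, on which composition is [tab_mul]. *)
Definition tab_perm (s : seq nat) : {perm 'I_5} :=
  insubd (1 : {perm 'I_5}) [ffun i : 'I_5 => inord (nth 0%N s i)].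

Definition tab (s : seq nat) := perm_eq s (iota 0 5).
Definition tab_mul (s t : seq nat) := [seq nth 0 t i | i <- s].

Lemma tab_size s : tab s -> size s = 5%N.
Proof. by move/perm_size. Qed.

Lemma tab_lt s i : tab s -> i < 5 -> nth 0 s i < 5.
Proof.
move=> ts lti; have := mem_nth 0 (_ : i < size s); rewrite tab_size // => /(_ lti).
by rewrite (perm_mem ts) mem_iota.
Qed.

Lemma tab_permE s (i : 'I_5) : tab s -> tab_perm s i = nth 0 s i :> nat.
Proof.
move=> ts; rewrite /tab_perm /insubd insubT /=; last first.
  by move=> ?; rewrite [fun_of_perm]unlock /= ffunE inordK // tab_lt.
apply/injectiveP=> j k; rewrite !ffunE => /(congr1 val); rewrite /= !inordK ?tab_lt //.
have us : uniq s by rewrite (perm_uniq ts) iota_uniq.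
move/eqP; rewrite nth_uniq ?tab_size ?ltn_ord //.
by move/eqP/val_inj.
Qed.

Lemma tab_mulP s t : tab s -> tab t -> tab (tab_mul s t).
Proof.
move=> ts tt; rewrite /tab /tab_mul; apply: perm_trans (perm_map _ ts) _.
by rewrite -/(mkseq _ 5) -(tab_size tt) mkseq_nth (tab_size tt).
Qed.

Lemma tab_permM s t : tab s -> tab t ->
  tab_perm s * tab_perm t = tab_perm (tab_mul s t).
Proof.
move=> ts tt; apply/permP=> i; apply: val_inj; rewrite permM /= !tab_permE ?tab_mulP //.
by rewrite (nth_map 0%N) ?tab_size.
Qed.

Lemma tab_perm_inj : {in tab &, injective tab_perm}.
Proof.
move=> s t ts tt eqst; apply: (@eq_from_nth _ 0%N); rewrite ?tab_size // => i lti.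
by rewrite -(tab_permE (Ordinal lti) ts) eqst tab_permE.
Qed.

Lemma tab_permJ s t r : tab s -> tab t -> tab r ->
  tab_mul s t = tab_mul t r -> tab_perm s ^ tab_perm t = tab_perm r.
Proof.
by move=> ts tt tr e; rewrite conjgE tab_permM // e -tab_permM // mulKg.
Qed.

Lemma tab_perm1 : tab_perm (iota 0 5) = 1.
Proof.
by apply/permP=> i; apply: val_inj; rewrite perm1 [LHS](tab_permE i) // nth_iota.
Qed.

Lemma order_tab_perm p s : prime p -> tab s ->
  iterop p tab_mul s (iota 0 5) = iota 0 5 -> s != iota 0 5 -> #[tab_perm s] = p.
Proof.
move=> pr_p ts e ns; apply: nt_prime_order => //; last first.
  by apply: contraNneq ns; rewrite -tab_perm1 => /tab_perm_inj->.
case: p pr_p e => // p _; rewrite expgnE.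
pose pow q := iterop q.+1 tab_mul s (iota 0 5).
suff powE q : iterop q.+1 mulg (tab_perm s) 1 = tab_perm (pow q) /\ tab (pow q).
  by move=> e; rewrite (powE p).1 /pow e tab_perm1.
rewrite /pow.
elim: q => //= q [-> tq]; split; last exact: tab_mulP.
by rewrite tab_permM.
Qed.

Definition cyc5_tab : seq nat := [:: 1; 2; 3; 4; 0]%N.
Definition cyc3_tab : seq nat := [:: 0; 4; 1; 3; 2]%N.
(** On the points read modulo 5, [cyc5] is [i |-> i + 1] and this is
    [i |-> 2 * i], an odd permutation. *)
Definition dbl_tab : seq nat := [:: 0; 2; 4; 1; 3]%N.
Definition cyc5 := tab_perm cyc5_tab.
Definition cyc3 := tab_perm cyc3_tab.

Lemma odd_order_Ico g : odd #[g] -> g \in Ico.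
Proof.
move=> oddg; rewrite Alt_even -(expg1 g).
have <- : g ^+ (#[g].+1)./2 * g ^+ (#[g].+1)./2 = g ^+ 1.
  by rewrite -expgD addnn even_halfK /= ?oddg // expgS expg_order mulg1 expg1.
by rewrite odd_permM addbb.
Qed.

Lemma order_cyc5 : #[cyc5] = 5%N. Proof. exact: order_tab_perm. Qed.
Lemma order_cyc3 : #[cyc3] = 3%N. Proof. exact: order_tab_perm. Qed.
Lemma order_cyc5cyc3 : #[cyc5 * cyc3] = 2%N.
Proof. by rewrite tab_permM //; apply: order_tab_perm. Qed.

Lemma cyc5_Ico : cyc5 \in Ico. Proof. by rewrite odd_order_Ico ?order_cyc5. Qed.
Lemma cyc3_Ico : cyc3 \in Ico. Proof. by rewrite odd_order_Ico ?order_cyc3. Qed.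

(** A group containing elements of orders 5, 3 and 2 has order divisible by 30,
    so inside A5 it has index at most 2, and A5 is simple. *)
Lemma Ico_gen (G : {group {perm 'I_5}}) : cyc5 \in G -> cyc3 \in G -> Ico \subset G.
Proof.
move=> Gc Gt; pose K := (G :&: Ico)%G.
have Kc : cyc5 \in K by rewrite inE Gc cyc5_Ico.
have Kt : cyc3 \in K by rewrite inE Gt cyc3_Ico.
have sKI : K \subset Ico by apply: subsetIr.
have d5 : (5 %| #|K|)%N by have := order_dvdG Kc; rewrite order_cyc5.
have d3 : (3 %| #|K|)%N by have := order_dvdG Kt; rewrite order_cyc3.
have d2 : (2 %| #|K|)%N by have := order_dvdG (groupM Kc Kt); rewrite order_cyc5cyc3.
have d30 : (30 %| #|K|)%N.
  by rewrite (@Gauss_dvd 6 5) // (@Gauss_dvd 2 3) // d2 d3 d5.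
have := Lagrange sKI; rewrite card_Ico; case/dvdnP: d30 => k ->.
rewrite -mulnA => eK; have ek : (k * #|Ico : K| = 2)%N by lia.
have := dvdn_mull k (dvdnn #|Ico : K|); rewrite ek.
have [_ primed2] := primeP (isT : prime 2).
case/primed2/pred2P=> [i1 | i2]; last first.
  by have := simple_index2 simple_Ico sKI i2; rewrite card_Ico.
by move/eqP: i1; rewrite indexg_eq1 => sIK; rewrite (subset_trans sIK) ?subsetIl.
Qed.

Local Notation P5 := <[cyc5]>%G.

Lemma P5_syl : 5.-Sylow(Ico) P5.
Proof.
by rewrite pHallE cycle_subG cyc5_Ico /= -orderE order_cyc5 card_Ico p_part.
Qed.

Lemma cyc5_dbl : cyc5 ^ tab_perm dbl_tab = cyc5 ^+ 2.
Proof.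
by rewrite (@tab_permJ _ _ [:: 2; 3; 4; 0; 1]%N) // expgS expg1 /cyc5 tab_permM.
Qed.

(** * The order of the normaliser *)

Lemma im_conj (f f' : {morphism Ico >-> B6}) A :
  {in Ico, forall g, f' g = f g ^ A} -> f' @* Ico = (f @* Ico) :^ A.
Proof.
move=> fA; apply/setP=> B; rewrite mem_conjg.
apply/morphimP/morphimP => -[g Ig _ eB]; exists g => //.
  by rewrite eB fA // conjgK.
by rewrite fA // -eB conjgKV.
Qed.

(** An odd power of a map that exchanges two opposite axes exchanges them. *)
Lemma no_flip p (m : B6) : m ^+ 5 = 1 -> axact p m != opp_axis p.
Proof.
move=> m5; apply/eqP=> pm; have := congr1 (axact p) m5.
rewrite !expgS expg0 mulg1 !axactM axact1 !(pm, axact_opp) !opp_axisK.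
by apply/eqP/opp_axis_neq.
Qed.

Section Normaliser.

Variable f : {morphism Ico >-> B6}.
Hypothesis anti_f : antipodal f.

Let H := (f @* Ico)%G.
Let N := 'N(H)%G.
Let b := f cyc5.
Let injf : 'injm f. Proof. by case: anti_f. Qed.
Let sP := P5_syl.

Let order_b : #[b] = 5%N.
Proof. by rewrite order_injm ?cyc5_Ico // order_cyc5. Qed.

Let imP : f @* P5 = <[b]>.
Proof. by rewrite morphim_cycle // cyc5_Ico. Qed.

(** Precomposing [f] with conjugation by the odd permutation [i |-> 2 * i] gives
    another antipodal embedding with the same image and the same fixed axes;
    [antipodal_conj] realises the change of embedding inside the normaliser. *)
Lemma exists_outer x : fixed_axis f P5 x ->
  exists A, [/\ A \in N, axact x A = x & b ^ A = b ^+ 2].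
Proof.
move=> fx; pose s := tab_perm dbl_tab.
have nIs g : (g ^ s \in Ico) = (g \in Ico) by rewrite !Alt_even odd_permJ.
have nIsV g : (g ^ s^-1 \in Ico) = (g \in Ico) by rewrite -(nIs (g ^ _)) conjgKV.
have fsM : {in Ico &, {morph (fun g => f (g ^ s)) : g h / g * h}}.
  by move=> g h Ig Ih; rewrite conjMg morphM ?nIs.
pose f' := Morphism fsM.
have im' : f' @* Ico = f @* Ico.
  apply/setP=> A; apply/imsetP/morphimP => [[g Ig ->]|[g Ig _ ->]].
    by rewrite setIid in Ig; exists (g ^ s); rewrite ?nIs.
  by exists (g ^ s^-1); rewrite ?setIid ?nIsV //= conjgKV.
have anti' : antipodal f'.
  split=> [|p].
    apply/injmP=> g h Ig Ih /= /(injmP injf) e; apply: (conjg_inj s).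
    by apply: e; rewrite nIs.
  have [_ /(_ p)[g Ig gp]] := anti_f; exists (g ^ s^-1); rewrite ?nIsV //.
  by rewrite /= conjgKV.
have fx' : fixed_axis f' P5 x.
  apply/(fixed_axisP f' sP) => _ /cycleP[k ->] /=.
  apply: (fixed_axisP f sP _ fx).
  by rewrite conjXg cyc5_dbl -expgM mem_cycle.
have [A xA fA] := antipodal_conj anti_f anti' sP fx fx'.
exists A; split=> //; first by rewrite inE -(im_conj fA) im'.
by rewrite -fA ?cyc5_Ico //= cyc5_dbl morphX ?cyc5_Ico.
Qed.

Variable x : axis.
Hypothesis fx : fixed_axis f P5 x.

Let stabH h : h \in H -> (axact x h == x) = (h \in <[b]>).
Proof.
case/morphimP=> g _ Ig ->; rewrite (axact_stab anti_f sP fx) // -imP.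
by apply/idP/morphimP=> [Pg | [k Ik Pk /(injmP injf)-> //]]; exists g.
Qed.

Let xb k : axact x (b ^+ k) = x.
Proof. by apply/eqP; rewrite stabH ?mem_cycle ?groupX ?mem_morphim ?cyc5_Ico. Qed.

Let Nx := 'C_N[x | axact_action]%G.

Let NxP g : reflect (g \in N /\ axact x g = x) (g \in Nx).
Proof. by rewrite in_setI; apply: (iffP andP) => -[Ng /astab1P]. Qed.

Let sHN : H \subset N. Proof. exact: normG. Qed.

Let b_H : b \in H. Proof. by rewrite mem_morphim ?cyc5_Ico. Qed.

Let b_Nx : b \in Nx.
Proof. by apply/NxP; rewrite (subsetP sHN) // -[b]expg1 xb. Qed.

Lemma card_norm_Nx : #|N| = (12 * #|Nx|)%N.
Proof.
rewrite -(card_orbit_stab axact_action N x); congr (_ * _)%N.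
suff -> : orbit axact_action N x = setT.
  by rewrite cardsT card_prod card_ord card_bool.
apply/setP=> p; rewrite inE; have [g Ig <-] := axact_transitive anti_f sP fx p.
by apply/orbitP; exists (f g); rewrite // (subsetP sHN) ?mem_morphim.
Qed.

(** The outer element [A] sends [b] to [b ^+ 2], and 2 has order 4 modulo 5, so
    the order of [A] is a multiple of 4. *)
Let dvd20 : (20 %| #|Nx|)%N.
Proof.
have := order_dvdG b_Nx; rewrite (@Gauss_dvd 4 5) // order_b => ->; rewrite andbT.
have [A [NA xA bA]] := exists_outer fx.
apply: dvdn_trans (order_dvdG (_ : A \in Nx)); last exact/NxP.
have bAn n : b ^ (A ^+ n) = b ^+ (2 ^ n).
  by elim: n => [|n IH]; rewrite ?conjg1 // expgSr conjgM IH conjXg bA -expgM expnS.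
have : b ^+ (2 ^ #[A]) == b ^+ 1 by rewrite -bAn expg_order conjg1.
rewrite eq_expg_mod_order order_b {1}(divn_eq #[A] 4) expnD (mulnC _ 4) expnM.
rewrite -modnMml -modnXm (_ : 2 ^ 4 %% 5 = 1)%N // exp1n /dvdn.
by have := ltn_pmod #[A] (isT : 0 < 4)%N; case: (_ %% 4) => [|[|[|[|]]]].
Qed.

Let bfix p : (axact p b == p) = (p == x) || (p == opp_axis x).
Proof.
rewrite -(fixed_axisE anti_f sP fx); apply/eqP/(fixed_axisP f sP) => [pb | fixp].
  move=> _ /cycleP[k ->]; rewrite morphX ?cyc5_Ico //.
  by elim: k => [|k IH]; rewrite ?axact1 // expgSr axactM IH.
by apply: fixp; apply: cycle_id.
Qed.

Let off p := (p != x) && (p != opp_axis x).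

Let b5 h : h \in <[b]> -> h ^+ 5 = 1.
Proof.
by case/cycleP=> k ->; rewrite -expgM mulnC expgM -order_b expg_order expg1n.
Qed.

Section Centraliser.

Variable y : axis.
Hypothesis off_y : off y.

Let O := orbit axact_action <[b]> y.

Let cardO : #|O| = 5%N.
Proof.
have := card_orbit_stab axact_action <[b]> y; rewrite -orderE order_b -/O.
have [_ primed5] := primeP (isT : prime 5).
move=> e; have := dvdn_mulr #|'C_<[b]>[y | axact_action]| (dvdnn #|O|).
rewrite e => /primed5/pred2P[] //.
move/card_orbit1 => O1; move: off_y; rewrite /off -negb_or -bfix.
suff : axact y b \in O by rewrite /O O1 inE => ->.
by apply/orbitP; exists b; rewrite ?cycle_id.
Qed.

Let O_flip p : p \in O -> opp_axis p \notin O.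
Proof.
case/orbitP=> h bh <-; apply/negP=> /orbitP[k bk] /=.
rewrite -[y in LHS](axactK h) -axactM; apply/eqP/no_flip/b5.
by rewrite groupM ?groupV.
Qed.

Let x_notin_O : x \notin O /\ opp_axis x \notin O.
Proof.
case/andP: off_y => yx yox.
split; apply/negP=> /orbitP[_ /cycleP[k ->]] /(canRL (axactK _)) e.
  by case/eqP: yx; rewrite e -{1}(xb k) axactK.
by case/eqP: yox; rewrite e axact_opp -{1}(xb k) axactK.
Qed.

(** The twelve axes are [x], [- x], the five axes of [O] and their opposites. *)
Let off_O p : off p = (p \in O) || (opp_axis p \in O).
Proof.
have [xO oxO] := x_notin_O; pose O' := opp_axis @: O.
have inO' q : (q \in O') = (opp_axis q \in O).
  by rewrite -[in RHS](mem_imset _ _ (inv_inj opp_axisK)) opp_axisK.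
have dOO' : O :&: O' = set0.
  apply/setP=> q; rewrite in_setI inO' in_set0.
  by apply/andP=> -[/O_flip/negP].
have dx : [set x; opp_axis x] :&: (O :|: O') = set0.
  apply/setP=> q; rewrite in_setI in_set2 in_setU inO' in_set0.
  by apply/andP=> -[/pred2P[]->]; rewrite ?opp_axisK (negPf xO) (negPf oxO).
have /setP/(_ p) : [set x; opp_axis x] :|: (O :|: O') = setT.
  apply/eqP; rewrite eqEcard subsetT cardsT card_prod card_ord card_bool.
  have cardO' : #|O'| = 5%N.
    by rewrite card_imset ?cardO //; apply: inv_inj opp_axisK.
  rewrite cardsU dx cards0 cards2 cardsU dOO' cards0 cardO cardO'.
  by rewrite eq_sym opp_axis_neq.
rewrite !in_setU inO' in_set1 in_set1 in_setT /off.
have [->|_] := eqVneq p x; first by rewrite (negPf xO) (negPf oxO).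
have [->|_] := eqVneq p (opp_axis x); last by rewrite /= => ->.
by rewrite opp_axisK (negPf xO) (negPf oxO).
Qed.

Let C := 'C_Nx[b]%G.

Let eq_on_C g : g \in Nx -> commute g b -> axact y g = y -> g = 1.
Proof.
case/NxP=> _ xg gb yg; have Og p : p \in O -> axact p g = p.
  case/orbitP=> _ /cycleP[k ->] <- /=; rewrite -axactM.
  by rewrite -(commuteX k gb) axactM yg.
apply: axact_faithful => p; rewrite axact1.
have := off_O p; rewrite /off; have [-> //|_] := eqVneq p x.
have [-> _|_] := eqVneq p (opp_axis x); first by rewrite axact_opp xg.
move/esym/orP=> [/Og // | /Og].
by rewrite axact_opp => /(inv_inj opp_axisK).
Qed.

(** Suppose [g] fixes [x], commutes with [b] and negates [y].  Then it negates
    all axes except [x] and [- x].  If [u] in H carries [x] to [y], the commutator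
    of [g] and [u] lies in H, since [g] normalises H; it negates the lines of [x]
    and [y] and fixes the other axes.  But an element of H that fixes an axis has
    order 1 or 5, and cannot negate one. *)
Let no_flip_C g : g \in Nx -> commute g b -> axact y g != opp_axis y.
Proof.
move=> Nxg gb; apply/eqP=> yg; have [Ng xg] := NxP _ Nxg.
have flipg p : off p -> axact p g = opp_axis p.
  have Og q : q \in O -> axact q g = opp_axis q.
    case/orbitP=> _ /cycleP[k ->] <- /=; rewrite -axactM.
    by rewrite -(commuteX k gb) axactM yg axact_opp.
  rewrite off_O => /orP[/Og // | /Og].
  by rewrite axact_opp => /(inv_inj opp_axisK).
have offN p : off (opp_axis p) = off p.
  rewrite /off (inj_eq (inv_inj opp_axisK)) andbC.
  by rewrite -{2}(opp_axisK x) (inj_eq (inv_inj opp_axisK)).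
have flipgV p : off p -> axact p g^-1 = opp_axis p.
  by move=> offp; rewrite -[p in LHS]opp_axisK -flipg ?offN // axactK.
have xgV : axact x g^-1 = x by rewrite -{1}xg axactK.
have [u Hu xu] : exists2 u, u \in H & axact x u = y.
  have [k Ik <-] := axact_transitive anti_f sP fx y.
  by exists (f k); rewrite ?mem_morphim.
pose m := [~ g, u].
have Hm : m \in H by rewrite /m commgEr groupM // memJ_norm ?groupV.
have mE q : q != y -> q != opp_axis y -> axact q (g ^ u) = opp_axis q.
  move=> qy qoy; rewrite conjgE !axactM flipg ?axact_opp ?axactKV //.
  rewrite /off; apply/andP; split.
    by apply: contraNneq qy => qx; rewrite -(axactKV u q) qx xu.
  by apply: contraNneq qoy => qx; rewrite -(axactKV u q) qx axact_opp xu.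
have [xy xoy] : x != y /\ x != opp_axis y.
  have /andP[yx yox] := off_y; rewrite eq_sym; split=> //.
  by apply: contraNneq yox => ->; rewrite opp_axisK.
have xm : axact x m = opp_axis x by rewrite axactM xgV mE.
have [p [yp oyp offp]] : exists p, [/\ p != y, p != opp_axis y & off p].
  exists (axact y b); rewrite no_flip ?b5 ?cycle_id // bfix.
  have Oyb : axact y b \in O by apply/orbitP; exists b; rewrite ?cycle_id.
  by rewrite off_O Oyb; split=> //; rewrite negb_or.
have pm : axact p m = p.
  rewrite axactM flipgV // mE ?opp_axisK ?(inj_eq (inv_inj opp_axisK)) //.
  by apply: contraNneq oyp => <-; rewrite opp_axisK.
have [v Hv pv] : exists2 v, v \in H & axact x v = p.
  have [k Ik <-] := axact_transitive anti_f sP fx p.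
  by exists (f k); rewrite ?mem_morphim.
have /b5 : m ^ v^-1 \in <[b]>.
  rewrite -stabH ?groupJ ?groupV // conjgE invgK axactM pv axactM pm.
  by rewrite -pv axactK.
rewrite -conjXg => /(canRL (conjgKV v)); rewrite conj1g => m5.
by have := no_flip x m5; rewrite xm eqxx.
Qed.

(** An element of [C] is determined by the image of [y], which lies in [O]: were
    it the opposite of [y * h] with [h] a power of [b], then [g * h^-1] would
    negate [y]. *)
Lemma card_C : #|C| <= 5.
Proof.
have CP g : g \in C -> g \in Nx /\ commute g b.
  by rewrite in_setI => /andP[Nxg /cent1P].
rewrite -cardO -(card_in_imset (f := axact y) (D := C)).
  apply/subset_leq_card/subsetP=> _ /imsetP[g Cg ->].
  have [Nxg gb] := CP g Cg; have [Ng xg] := NxP _ Nxg.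
  have : off (axact y g).
    have := off_y; rewrite /off -!(inj_eq (@axact_inj g) y) axact_opp.
    by rewrite xg.
  rewrite off_O => /orP[// | /orbitP[h bh]] /= /esym oygh.
  have [k eh] := cycleP _ _ bh.
  have Nxh : h \in Nx by rewrite eh groupX.
  have ghb : commute (g * h^-1) b.
    apply/commute_sym/commuteM; first exact: commute_sym.
    by apply: commuteV; rewrite eh; apply: commuteX.
  have := no_flip_C (groupM Nxg (groupVr Nxh)) ghb; case/eqP.
  by rewrite axactM -[axact y g]opp_axisK oygh axact_opp axactK.
move=> g h /CP[Nxg gb] /CP[Nxh hb] e; apply/eqP; rewrite eq_mulgV1.
apply/eqP/eq_on_C; first by rewrite groupM ?groupV.
  apply/commute_sym/commuteM; first exact: commute_sym.
  exact/commuteV/commute_sym.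
by rewrite axactM e axactK.
Qed.

End Centraliser.

(** Conjugation by [Nx] moves [b] among the four generators of [<[b]>], and the
    stabiliser [C] of [b] has at most five elements. *)
Lemma card_Nx : #|Nx| = 20%N.
Proof.
apply/eqP; rewrite eqn_leq (dvdn_leq _ dvd20) ?cardG_gt0 // andbT.
have [i nix] : exists i, i != x.1.
  exists (if x.1 == ord0 then ord_max else ord0).
  by have [->|] := eqVneq x.1 ord0; rewrite // eq_sym.
have offy : off (i, false).
  by apply/andP; split; apply: contraNneq nix => /(congr1 fst) /= ->.
rewrite -(Lagrange (subsetIl Nx 'C[b])) index_cent1 (@leq_mul _ _ 5 4) //.
  exact: card_C offy.
have -> : 4%N = #|<[b]>^#| by rewrite cardsDS ?sub1G // cards1 -orderE order_b.
apply/subset_leq_card/subsetP=> _ /imsetP[g /NxP[Ng xg] ->].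
rewrite !inE -stabH ?memJ_norm // ?(conjg_eq1) -?order_eq1 ?order_b //=.
by rewrite conjgE !axactM -{1}xg axactK -[b]expg1 xb xg.
Qed.

Lemma card_normaliser : #|N| = 240%N.
Proof. by rewrite card_norm_Nx card_Nx. Qed.

End Normaliser.

(** * Splitting a representation by an involution *)

Local Open Scope ring_scope.

Section Corners.

Variables (F : numFieldType) (gT : finGroupType) (G : {group gT}) (n : nat).
Variable rG : mx_representation F G n.

(** In characteristic 0 the rank of an idempotent is its trace; the factors are
    the inclusion and the projection of its image. *)
Lemma idempotent_factor (e : 'M[F]_n) r : e *m e = e -> \tr e = r%:R ->
  exists E : 'M_(r, n), exists D : 'M_(n, r), D *m E = e /\ E *m D = 1%:M.
Proof.
move=> ee tre; set E := row_base e; set D := col_base e.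
have DE : D *m E = e := mulmx_base e.
have ED : E *m D = 1%:M.
  apply: (row_free_inj (row_base_free e)); apply: (row_full_inj (col_base_full e)).
  by rewrite -/E -/D mul1mx mulmxA mulmxA -mulmxA DE ee.
have rk : \rank e = r.
  apply/eqP; rewrite -(eqr_nat F) -tre -[X in \tr X]DE.
  by rewrite mxtrace_mulC ED mxtrace1.
by clearbody E D; move: E D DE ED; rewrite rk => E D; exists E, D.
Qed.

Definition intertwines m1 m2 (T1 : mx_representation F G m1)
  (T2 : mx_representation F G m2) (B : 'M_(m1, m2)) :=
  forall g, g \in G -> T1 g *m B = B *m T2 g.

Section Corner.

Variables (r : nat) (E : 'M[F]_(r, n)) (D : 'M[F]_(n, r)).
Hypotheses (ED : E *m D = 1%:M) (cDE : intertwines rG rG (D *m E)).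

Lemma corner_mx_repr : mx_repr G (fun g => E *m rG g *m D).
Proof.
split=> [|x y Gx Gy]; first by rewrite repr_mx1 mulmx1.
have -> : E *m rG x *m D *m (E *m rG y *m D)
          = E *m (rG x *m (D *m E)) *m rG y *m D.
  by rewrite !mulmxA.
by rewrite cDE // repr_mxM // !mulmxA ED mul1mx.
Qed.

(** The action of [G] on the image of the invariant idempotent [D *m E], in the
    coordinates given by the rows of [E]. *)
Definition corner_repr : mx_representation F G r := MxRepresentation corner_mx_repr.

Lemma corner_inj : intertwines corner_repr rG E.
Proof. by move=> g Gg; rewrite /= -!mulmxA cDE // !mulmxA ED mul1mx. Qed.

Lemma corner_proj : intertwines rG corner_repr D.
Proof.
by move=> g Gg; rewrite /= !mulmxA -cDE // -!mulmxA ED mulmx1.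
Qed.

End Corner.

Lemma intertwines_comp m1 m2 m3 (T1 : mx_representation F G m1)
    (T2 : mx_representation F G m2) (T3 : mx_representation F G m3) B C :
  intertwines T1 T2 B -> intertwines T2 T3 C -> intertwines T1 T3 (B *m C).
Proof. by move=> hB hC g Gg; rewrite mulmxA hB // -mulmxA hC // mulmxA. Qed.

Variable S : 'M[F]_n.
Hypotheses (SS : S *m S = 1%:M) (cS : intertwines rG rG S).
Hypothesis commutant :
  forall M, intertwines rG rG M -> exists a b, M = a%:M + b *: S.

(** For [u] a sign, the projector on the eigenspace of [S] for [u]. *)
Definition eigenproj (u : F) : 'M[F]_n := 2^-1 *: (1%:M + u *: S).

Lemma eigenproj_idem u : u ^+ 2 = 1 -> eigenproj u *m eigenproj u = eigenproj u.
Proof.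
move=> u2; rewrite /eigenproj -scalemxAl -scalemxAr mulmxDl mul1mx mulmxDr mulmx1.
rewrite -scalemxAl -scalemxAr SS scalerA -expr2 u2 scale1r.
rewrite addrACA [u *: S + _]addrC -mulr2n -[X in _ *: (_ *: X)]scaler_nat.
by rewrite [_ *: (2%:R *: _)]scalerA mulVf ?pnatr_eq0 // scale1r.
Qed.

Lemma eigenproj_orth u : u ^+ 2 = 1 -> eigenproj u *m eigenproj (- u) = 0.
Proof.
move=> u2; rewrite /eigenproj -scalemxAl -scalemxAr mulmxDl mul1mx mulmxDr mulmx1.
rewrite -scalemxAl -scalemxAr SS scalerA mulrN -expr2 u2 !scaleNr scale1r.
by rewrite -addrA addKr subrr !scaler0.
Qed.

Lemma eigenproj_comm u : intertwines rG rG (eigenproj u).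
Proof.
move=> g Gg; rewrite /eigenproj -scalemxAl -scalemxAr mulmxDl mulmxDr.
by rewrite mulmx1 mul1mx -scalemxAl -scalemxAr cS.
Qed.

Lemma eigenprojS u : u ^+ 2 = 1 -> eigenproj u *m S = u *: eigenproj u.
Proof.
move=> u2; rewrite /eigenproj -scalemxAl mulmxDl mul1mx -scalemxAl SS.
rewrite [RHS]scalerA mulrC -scalerA; congr (_ *: _).
by rewrite scalerDr scalerA -expr2 u2 scale1r addrC.
Qed.

Section Eigen.

Variables (r : nat) (E : 'M[F]_(r, n)) (D : 'M[F]_(n, r)) (u : F).
Hypotheses (u2 : u ^+ 2 = 1) (DE : D *m E = eigenproj u) (ED : E *m D = 1%:M).

Lemma corner_S : E *m S = u *: E.
Proof.
rewrite -[E]mul1mx -ED -!mulmxA (mulmxA D) DE eigenprojS // -DE.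
by rewrite -scalemxAr.
Qed.

Lemma corner_comm : intertwines rG rG (D *m E).
Proof. by rewrite DE; apply: eigenproj_comm. Qed.

(** An endomorphism of an eigenspace of [S], extended by 0, commutes with [G]; it
    is a combination of 1 and [S], and both are scalar on the eigenspace. *)
Lemma corner_scalar B :
  intertwines (corner_repr ED corner_comm) (corner_repr ED corner_comm) B ->
  exists a, B = a%:M.
Proof.
move=> hB; have hM := intertwines_comp
  (intertwines_comp (corner_proj ED corner_comm) hB) (corner_inj ED corner_comm).
have [a [b defM]] := commutant hM; exists (a + b * u).
have -> : B = E *m (D *m B *m E) *m D.
  by rewrite !mulmxA ED mul1mx -mulmxA ED mulmx1.
rewrite defM mulmxDr mulmxDl mul_mx_scalar -scalemxAl ED -scalemxAr corner_S.
by rewrite scalerA -scalemxAl ED -scalerDl scalemx1.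
Qed.

(** By Maschke's theorem a nonzero submodule is the image of an equivariant
    projector; this is a scalar, hence 1. *)
Lemma corner_irr : [pchar F]^'.-group G -> (0 < r)%N ->
  mx_irreducible (corner_repr ED corner_comm).
Proof.
move=> chG r_gt0; apply/mx_irrP; split=> // U modU nzU.
have [W modW defUW /mxdirect_addsP dxUW] := mx_Maschke_pchar _ chG modU (submx1 _).
have homP := proj_mx_hom dxUW modU modW.
have [g Gg|a defP] := @corner_scalar (proj_mx U W).
  have sub1 : (1%:M <= dom_hom_mx (corner_repr ED corner_comm) (proj_mx U W))%MS.
    by apply: submx_trans homP; rewrite defUW.
  by have := hom_mxP sub1 g Gg; rewrite !mul1mx.
have: U *m proj_mx U W = U by rewrite proj_mx_id.
rewrite defP mul_mx_scalar => aU.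
have a1 : a = 1.
  apply/eqP; rewrite -subr_eq0; apply: contraNT nzU => nza.
  have : (a - 1) *: U == 0 by rewrite scalerBl aU scale1r subrr.
  by rewrite scaler_eq0 (negPf nza).
by rewrite -sub1mx (_ : 1%:M = 1%:M *m proj_mx U W) ?proj_mx_sub // defP a1 mulmx1.
Qed.

End Eigen.

Lemma corner_sum_rsim r1 r2 (E1 : 'M[F]_(r1, n)) (D1 : 'M[F]_(n, r1))
    (E2 : 'M[F]_(r2, n)) (D2 : 'M[F]_(n, r2))
    (ED1 : E1 *m D1 = 1%:M) (ED2 : E2 *m D2 = 1%:M)
    (c1 : intertwines rG rG (D1 *m E1)) (c2 : intertwines rG rG (D2 *m E2)) :
  n = (r1 + r2)%N -> D1 *m E1 + D2 *m E2 = 1%:M ->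
  mx_rsim rG (dadd_grepr (Representation (corner_repr ED1 c1))
                         (Representation (corner_repr ED2 c2))).
Proof.
move=> n12 sum1; exists (row_mx D1 D2) => [//||g Gg].
  by apply/row_freeP; exists (col_mx E1 E2); rewrite mul_row_col.
have h1 := corner_proj ED1 c1 Gg; have h2 := corner_proj ED2 c2 Gg.
by rewrite mul_mx_row h1 h2 mul_row_block !mulmx0 addr0 add0r.
Qed.

(** An equivalence between the eigenspaces, extended by 0, would be a
    combination of 1 and [S], and these preserve each eigenspace. *)
Lemma corner_not_rsim r1 r2 (E1 : 'M[F]_(r1, n)) (D1 : 'M[F]_(n, r1))
    (E2 : 'M[F]_(r2, n)) (D2 : 'M[F]_(n, r2)) u
    (ED1 : E1 *m D1 = 1%:M) (ED2 : E2 *m D2 = 1%:M)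
    (c1 : intertwines rG rG (D1 *m E1)) (c2 : intertwines rG rG (D2 *m E2)) :
    u ^+ 2 = 1 -> D1 *m E1 = eigenproj u -> D2 *m E2 = eigenproj (- u) ->
    (0 < r1)%N ->
  ~ mx_rsim (corner_repr ED1 c1) (corner_repr ED2 c2).
Proof.
move=> u2 DE1 DE2 r1_gt0 [B _ freeB hB].
have hM := intertwines_comp (intertwines_comp (corner_proj ED1 c1) hB)
  (corner_inj ED2 c2).
have [a [b defM]] := commutant hM; have S1 := corner_S u2 DE1 ED1.
have E1D2 : E1 *m D2 = 0.
  rewrite -[E1]mul1mx -ED1 -(mulmxA E1) DE1 -[D2]mulmx1 -ED2 (mulmxA D2) DE2.
  by rewrite mulmxA -(mulmxA E1) eigenproj_orth // mulmx0 mul0mx.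
have B0 : B = 0.
  have -> : B = E1 *m (D1 *m B *m E2) *m D2.
    by rewrite !mulmxA ED1 mul1mx -mulmxA ED2 mulmx1.
  rewrite defM mulmxDr mulmxDl mul_mx_scalar -scalemxAl E1D2 scaler0 add0r.
  by rewrite -scalemxAr S1 -!scalemxAl E1D2 !scaler0.
by move: freeB r1_gt0; rewrite /row_free B0 mxrank0 => /eqP<-.
Qed.

Lemma eigenproj_trace u : \tr S = 0 -> \tr (eigenproj u) = 2^-1 * n%:R.
Proof.
by move=> trS; rewrite mxtraceZ mxtraceD mxtrace1 mxtraceZ trS mulr0 addr0.
Qed.

End Corners.

(** The trace condition makes the two eigenspaces of [S] of equal dimension. *)
Lemma involution_splits (F : numFieldType) (gT : finGroupType) (G : {group gT})
    (r : nat) (rG : mx_representation F G (r + r)) (S : 'M_(r + r)) :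
    (0 < r)%N -> [pchar F]^'.-group G ->
    S *m S = 1%:M -> \tr S = 0 -> intertwines rG rG S ->
    (forall M, intertwines rG rG M -> exists a b, M = a%:M + b *: S) ->
  exists T1 T2 : mx_representation F G r,
    [/\ mx_irreducible T1, mx_irreducible T2, ~ mx_rsim T1 T2
      & mx_rsim rG (dadd_grepr (Representation T1) (Representation T2))].
Proof.
move=> r_gt0 chG SS trS cS com; pose u : F := 1.
have u2 : u ^+ 2 = 1 by rewrite expr1n.
have Nu2 : (- u) ^+ 2 = 1 by rewrite sqrrN.
have trE v : \tr (eigenproj S v) = r%:R.
  by rewrite eigenproj_trace // addnn -mul2n natrM mulKf ?pnatr_eq0.
have [E1 [D1 [DE1 ED1]]] := idempotent_factor (eigenproj_idem SS u2) (trE u).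
have [E2 [D2 [DE2 ED2]]] :=
  idempotent_factor (eigenproj_idem SS Nu2) (trE (- u)).
pose c1 := corner_comm cS DE1; pose c2 := corner_comm cS DE2.
exists (corner_repr ED1 c1), (corner_repr ED2 c2); split.
- exact: (corner_irr SS).
- exact: (corner_irr SS).
- exact: (corner_not_rsim SS com u2).
apply: corner_sum_rsim => //; rewrite DE1 DE2 -scalerDr scaleNr addrACA subrr addr0.
by rewrite -mulr2n -scaler_nat scalerA mulVf ?pnatr_eq0 // scale1r.
Qed.

Lemma irr_fixed_free (F : fieldType) (gT : finGroupType) (G : {group gT}) (n : nat)
    (rG : mx_representation F G n) (v : 'rV_n) :
    (1 < n)%N -> mx_irreducible rG ->
  (forall g, g \in G -> v *m rG g = v) -> v = 0.
Proof.
move=> n_gt1 /mx_irrP[_ irrG] vG; apply/eqP; apply: contraT => nzv.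
have modv : mxmodule rG <<v>>%MS.
  by rewrite (eqmx_module _ (genmxE v)); apply/mxmoduleP=> g Gg; rewrite vG.
have /irrG : <<v>>%MS != 0 by rewrite -mxrank_eq0 genmxE mxrank_eq0.
move/(_ modv); rewrite /row_full genmxE => /eqP rv.
by have := rank_leq_row v; rewrite rv leqNgt n_gt1.
Qed.

(** * Crystallographic subgroups are antipodal *)

Section Real.

Variable R : realType.

Definition vecR (p : axis) : 'rV[R]_6 := map_mx intr (vec p).
Definition rmx (A : B6) : 'M[R]_6 := map_mx intr (B6val A).

Lemma vecR_axact p A : vecR (axact p A) = vecR p *m rmx A.
Proof. by rewrite /vecR vec_axact map_mxM. Qed.

Lemma vecR_opp p : vecR (opp_axis p) = - vecR p.
Proof. by rewrite /vecR vec_opp map_mxN. Qed.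

Lemma rmxT A : rmx A *m (rmx A)^T = 1%:M.
Proof. by rewrite /rmx map_trmx -map_mxM B6_mulT map_mx1. Qed.

Definition bil (M : 'M[R]_6) (p q : axis) : R := (vecR p *m M *m (vecR q)^T) 0 0.

Lemma vecRE i : vecR (i, false) = delta_mx 0 i.
Proof. by rewrite /vecR /vec scale1r map_delta_mx. Qed.

Lemma bilE M p q : bil M p q = (-1) ^+ p.2 * (-1) ^+ q.2 * M p.1 q.1.
Proof.
have e r : vecR r = (-1) ^+ r.2 *: delta_mx 0 r.1.
  by case: r => i []; rewrite -vecRE ?scale1r // scaleN1r -vecR_opp.
rewrite /bil !e linearZ /= -scalemxAr -!scalemxAl -rowE trmx_delta -colE !mxE.
by rewrite mulrA [X in X * _]mulrC.
Qed.

Lemma vecR_dot p q :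
  (vecR p *m (vecR q)^T) 0 0 = (-1) ^+ (p.2 (+) q.2) * (p.1 == q.1)%:R.
Proof. by have := bilE 1%:M p q; rewrite /bil mulmx1 signr_addb [_%:M _ _]mxE. Qed.

Lemma vecR_dot_ge0 p q : p != opp_axis q -> 0 <= (vecR p *m (vecR q)^T) 0 0.
Proof.
rewrite vecR_dot; case: p q => i b [j d]; rewrite /opp_axis xpair_eqE /=.
by case: eqP; rewrite ?mulr0 //; case: b; case: d; rewrite ?mulr1 ?ler01.
Qed.

Lemma bil_axact M A : (forall p q, bil M (axact p A) (axact q A) = bil M p q) <->
  rmx A *m M = M *m rmx A.
Proof.
have AT := mulmx1C (rmxT A).
split=> [inv | com p q].
  suff e : rmx A *m M *m (rmx A)^T = M by rewrite -{2}e -mulmxA AT mulmx1.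
  apply/matrixP=> i j; have := inv (i, false) (j, false).
  rewrite {1}/bil !vecR_axact trmx_mul bilE !expr0 !mul1r /= => <-.
  by rewrite !vecRE trmx_delta !mulmxA -!mulmxA -rowE !mulmxA -colE !mxE.
rewrite /bil !vecR_axact trmx_mul -(mulmxA (vecR p)) com !mulmxA.
by rewrite -(mulmxA _ (rmx A)) rmxT mulmx1.
Qed.

Lemma T1T2_fixed_free (f : {morphism Ico >-> B6}) (T1 T2 : mx_representation R Ico 3)
    (w : 'rV_6) :
    mx_irreducible T1 -> mx_irreducible T2 ->
    mx_rsim (B6_pullback R f) (dadd_grepr (Representation T1) (Representation T2)) ->
  (forall g, g \in Ico -> w *m rmx (f g) = w) -> w = 0.
Proof.
move=> irr1 irr2 [B _ freeB hB] wf; pose v : 'M_(1, 3 + 3) := w *m B.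
suff v0 : v = 0 by apply: (row_free_inj freeB); rewrite mul0mx.
have vT g : g \in Ico -> lsubmx v *m T1 g = lsubmx v /\ rsubmx v *m T2 g = rsubmx v.
  move=> Ig; have : v *m block_mx (T1 g) 0 0 (T2 g) = v.
    by rewrite /v -mulmxA -hB // mulmxA wf.
  rewrite -{1 2}(hsubmxK v) mul_row_block !mulmx0 addr0 add0r.
  by case/eq_row_mx.
have l0 := irr_fixed_free (isT : (1 < 3)%N) irr1 (fun g Ig => (vT g Ig).1).
have r0 := irr_fixed_free (isT : (1 < 3)%N) irr2 (fun g Ig => (vT g Ig).2).
by rewrite -(hsubmxK v) l0 r0 row_mx0.
Qed.

(** The sum of the images of [p] is a fixed vector, hence zero.  If [- p] were
    not among them, every image would have a nonnegative coordinate along [p],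
    and the image by the identity has coordinate 1. *)
Lemma crystallographic_antipodal H : crystallographic R H ->
  exists2 f : {morphism Ico >-> B6}, antipodal f & f @* Ico = H.
Proof.
case=> f [/isomP[injf imf] [T1 [T2 [[irr1 irr2 _] sim]]]]; exists f => //.
split=> // p; have [|no_opp] := boolP [exists g in Ico, axact p (f g) == opp_axis p].
  by case/exists_inP=> g Ig /eqP; exists g.
exfalso; move: no_opp; rewrite negb_exists_in => /forall_inP no_opp.
pose w := \sum_(g in Ico) vecR (axact p (f g)).
have w0 : w = 0.
  apply: (T1T2_fixed_free irr1 irr2 sim) => h Ih.
  rewrite mulmx_suml [RHS](reindex_acts 'R _ Ih) ?astabsR //=.
  apply: eq_bigr => g Ig; rewrite morphM // axactM.
  by rewrite [RHS]vecR_axact.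
have : 0 < (w *m (vecR p)^T) 0 0.
  rewrite mulmx_suml summxE (bigD1 1%g) ?group1 //= ltr_pwDl //.
    by rewrite morph1 axact1 vecR_dot eqxx addbb mulr1.
  by apply: sumr_ge0 => g /andP[Ig _]; apply/vecR_dot_ge0/no_opp.
by rewrite w0 mul0mx mxE ltxx.
Qed.

End Real.

(** * The embedding given by the action on a class of 5-cycles *)

Local Close Scope ring_scope.
Local Open Scope group_scope.

(** The class of [cyc5] in A5: [cyc5] itself, the five conjugates by the powers of
    [cyc5] of another member, and then the inverses of these six. *)
Definition cyc_tabs : seq (seq nat) :=
  [:: [:: 1; 2; 3; 4; 0]; [:: 1; 3; 0; 4; 2]; [:: 3; 2; 4; 1; 0];
      [:: 1; 4; 3; 0; 2]; [:: 3; 2; 0; 4; 1]; [:: 2; 4; 3; 1; 0];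
      [:: 4; 0; 1; 2; 3]; [:: 2; 0; 4; 1; 3]; [:: 4; 3; 1; 0; 2];
      [:: 3; 0; 4; 2; 1]; [:: 2; 4; 1; 0; 3]; [:: 4; 3; 0; 2; 1]]%N.

(** Conjugation by [cyc5] and by [cyc3] on positions in [cyc_tabs]. *)
Definition img5 : seq nat := [:: 0; 2; 3; 4; 5; 1; 6; 8; 9; 10; 11; 7]%N.
Definition img3 : seq nat := [:: 11; 6; 4; 8; 9; 1; 5; 0; 10; 2; 3; 7]%N.

Definition code (p : axis) : nat := (p.1 + 6 * p.2)%N.
Definition decode (k : nat) : axis := (inord (k %% 6), 6 <= k)%N.

Definition cyc_tab (k : nat) : seq nat := nth [::] cyc_tabs k.
Definition cyc (p : axis) : {perm 'I_5} := tab_perm (cyc_tab (code p)).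

Lemma code_lt p : (code p < 12)%N.
Proof. by case: p => i []; rewrite /code /=; have := ltn_ord i; lia. Qed.

Lemma decodeK k : (k < 12)%N -> code (decode k) = k.
Proof.
move=> ltk; rewrite /code /= inordK ?ltn_mod //; case: leqP => h; lia.
Qed.

Lemma codeK : cancel code decode.
Proof.
case=> i b; rewrite /decode /code /=; congr (_, _); last first.
  by have := ltn_ord i; case: b; lia.
by apply: val_inj; rewrite /= inordK ?ltn_mod // addnC mulnC modnMDl modn_small.
Qed.

Lemma cyc_tabP k : (k < 12)%N -> tab (cyc_tab k).
Proof. by move=> ltk; apply: (allP (isT : all tab cyc_tabs)); rewrite mem_nth. Qed.

Lemma cyc_inj : injective cyc.
Proof.
move=> p q /tab_perm_inj; rewrite -!topredE /= !cyc_tabP ?code_lt // => /(_ isT isT)/eqP.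
by rewrite nth_uniq ?code_lt // => /eqP/(can_inj codeK).
Qed.

Lemma cyc_opp p : cyc (opp_axis p) = (cyc p)^-1%g.
Proof.
apply/eqP; rewrite eq_sym eq_invg_mul; apply/eqP.
rewrite tab_permM ?cyc_tabP ?code_lt // -[RHS]tab_perm1; congr tab_perm.
have /allP/(_ (code p)) : all (fun k => tab_mul (cyc_tab k)
    (cyc_tab ((k + 6) %% 12)) == iota 0 5)%N (iota 0 12) by [].
rewrite mem_iota code_lt => /(_ isT)/eqP <-; congr (tab_mul _ (cyc_tab _)).
by case: p => i []; rewrite /code /=; have := ltn_ord i; lia.
Qed.

Definition conj_table (g : seq nat) (img : seq nat) : bool :=
  all (fun k => (tab_mul (cyc_tab k) g == tab_mul g (cyc_tab (nth 0 img k)))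
   && (nth 0 img k < 12))%N (iota 0 12).

Lemma conj_tableP g img p : tab g -> conj_table g img ->
  cyc p ^ tab_perm g = cyc (decode (nth 0%N img (code p))).
Proof.
move=> tg /allP/(_ (code p)); rewrite mem_iota code_lt => /(_ isT)/andP[/eqP e lt12].
by apply: tab_permJ; rewrite ?cyc_tabP ?decodeK ?code_lt.
Qed.

Lemma cyc_cyc5 p : cyc p ^ cyc5 = cyc (decode (nth 0%N img5 (code p))).
Proof. exact: conj_tableP. Qed.

Lemma cyc_cyc3 p : cyc p ^ cyc3 = cyc (decode (nth 0%N img3 (code p))).
Proof. exact: conj_tableP. Qed.

Lemma cyc_conj g p : g \in Ico -> exists q, cyc p ^ g = cyc q.
Proof.
pose K := [set cyc q | q : axis].
suff nK : Ico \subset 'N(K).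
  move=> Ig; have : cyc p ^ g \in K by rewrite memJ_norm ?(subsetP nK) // imset_f.
  by case/imsetP=> q _ ->; exists q.
have norm_tab h img :
    (forall p, cyc p ^ h = cyc (decode (nth 0%N img (code p)))) -> h \in 'N(K).
  move=> hE; rewrite inE; apply/subsetP=> _ /imsetP[_ /imsetP[q _ ->] ->].
  by rewrite hE imset_f.
by apply: Ico_gen; apply: norm_tab; [apply: cyc_cyc5 | apply: cyc_cyc3].
Qed.

(** Conjugation commutes with inversion, so it permutes the axes as an element of
    [B6]. *)
Lemma exists_cyc_rep : exists f : {morphism Ico >-> B6},
  forall g p, g \in Ico -> cyc (axact p (f g)) = cyc p ^ g.
Proof.
have realise (g : {perm 'I_5}) : exists A : B6,
    g \in Ico -> forall p, cyc (axact p A) = cyc p ^ g.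
  have [Ig | _] := boolP (g \in Ico); last by exists 1%g.
  have [phi phiE] := fin_all_exists (fun p => cyc_conj p Ig).
  have phi_inj : injective phi.
    by move=> p q e; apply/cyc_inj/(conjg_inj g); rewrite !phiE e.
  have phi_opp p : phi (opp_axis p) = opp_axis (phi p).
    by apply: cyc_inj; rewrite -phiE !cyc_opp conjVg phiE.
  by have [A AE] := exists_B6 phi_inj phi_opp; exists A => _ p; rewrite AE phiE.
have [F FE] := fin_all_exists realise.
have FM : {in Ico &, {morph F : g h / (g * h)%g}}.
  move=> g h Ig Ih; apply: axact_faithful => p; apply: cyc_inj.
  by rewrite axactM !FE ?groupM // conjgM.
by exists (Morphism FM) => g p Ig; apply: FE.
Qed.

(** * The conference matrix and its eigenspaces *)

Local Open Scope ring_scope.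

(** The Gram matrix, up to its diagonal and a scalar, of the six diagonals of the
    icosahedron. *)
Definition conf_tab : seq (seq int) :=
  [:: [:: 0; 1; 1; 1; 1; 1]; [:: 1; 0; -1; 1; 1; -1]; [:: 1; -1; 0; -1; 1; 1];
      [:: 1; 1; -1; 0; -1; 1]; [:: 1; 1; 1; -1; 0; -1]; [:: 1; -1; 1; 1; -1; 0]].

Definition conf_entry (i j : nat) : int := nth 0 (nth [::] conf_tab i) j.
Definition conf : 'M[int]_6 := \matrix_(i, j) conf_entry i j.

Lemma conf_sq : conf *m conf = 5%:M.
Proof.
apply/matrixP=> i j; rewrite !mxE.
transitivity (foldr (fun k s => conf_entry i k * conf_entry k j + s) 0 (iota 0 6)).
  transitivity (\sum_(k < 6) conf_entry i k * conf_entry k j).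
    by apply: eq_bigr => k _; rewrite !mxE.
  by rewrite -(big_mkord xpredT (fun k => conf_entry i k * conf_entry k j)) unlock.
by case: i => -[|[|[|[|[|[|i]]]]]] // hi; case: j => -[|[|[|[|[|[|j]]]]]] // hj.
Qed.

Lemma conf_tr : \tr conf = 0.
Proof.
by apply: big1 => -[i hi] _; rewrite mxE /=; move: i hi; do 6?case=> //.
Qed.

Definition conf_signed (k l : nat) : int :=
  (-1) ^+ (6 <= k)%N * (-1) ^+ (6 <= l)%N * conf_entry (k %% 6) (l %% 6).

Definition conf_inv (img : seq nat) : bool :=
  all (fun k => all (fun l =>
    conf_signed (nth 0%N img k) (nth 0%N img l) == conf_signed k l)
    (iota 0 12)) (iota 0 12).

Lemma conf_inv5 : conf_inv img5. Proof. by vm_compute. Qed.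
Lemma conf_inv3 : conf_inv img3. Proof. by vm_compute. Qed.

Section Existence.

Variables (R : realType) (f : {morphism Ico >-> B6}).
Hypothesis f_cyc : forall g p, g \in Ico -> cyc (axact p (f g)) = (cyc p ^ g)%g.

Lemma axact_cyc5 p : axact p (f cyc5) = decode (nth 0%N img5 (code p)).
Proof. by apply: cyc_inj; rewrite f_cyc ?cyc5_Ico // cyc_cyc5. Qed.

Lemma axact_cyc3 p : axact p (f cyc3) = decode (nth 0%N img3 (code p)).
Proof. by apply: cyc_inj; rewrite f_cyc ?cyc3_Ico // cyc_cyc3. Qed.

Lemma cyc_rep_inj : 'injm f.
Proof.
have /simpleP[_ simI] := simple_Ico; case: (simI _ (ker_normal f)) => [-> // | kerI].
have /eqP : f cyc5 = 1%g by apply/mker; rewrite kerI cyc5_Ico.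
move/eqP => f1; have := axact_cyc5 (decode 1); rewrite f1 axact1 decodeK //.
by move/(congr1 code); rewrite !decodeK.
Qed.

Definition confR : 'M[R]_6 := map_mx intr conf.

Lemma bil_conf p q : bil confR p q = (conf_signed (code p) (code q))%:~R.
Proof.
have codeE r : (code r %% 6)%N = r.1 :> nat /\ (6 <= code r)%N = r.2.
  by case: r => i b; have := codeK (i, b) => -[/(congr1 val) e1 e2]; split=> //;
     move: e1; rewrite /= inordK ?ltn_mod.
have [p1 p2] := codeE p; have [q1 q2] := codeE q.
by rewrite bilE /conf_signed p1 p2 q1 q2 !mxE !intrM !rmorphXn /= rmorphN1.
Qed.

Lemma conf_invP g img : conf_inv img ->
    (forall p, axact p (f g) = decode (nth 0%N img (code p))) ->
    all (fun k => nth 0 img k < 12)%N (iota 0 12) ->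
  rmx R (f g) *m confR = confR *m rmx R (f g).
Proof.
move=> /allP inv gE /allP lt12; apply/bil_axact => p q.
have codeI r : code r \in iota 0 12 by rewrite mem_iota code_lt.
rewrite !bil_conf !gE !decodeK ?lt12 //.
by have /allP/(_ _ (codeI q))/eqP-> := inv _ (codeI p).
Qed.

(** The elements commuting with [confR] form a subgroup, so the two generators
    suffice. *)
Lemma conf_commutes : intertwines (B6_pullback R f) (B6_pullback R f) confR.
Proof.
pose G := [set g | (g \in Ico) && (rmx R (f g) *m confR == confR *m rmx R (f g))].
have gG : group_set G.
  apply/group_setP; split=> [|g h].
    by rewrite inE group1 morph1 /rmx map_mx1 mul1mx mulmx1 eqxx.
  case/setIdP=> Ig /eqP cg /setIdP[Ih /eqP ch].
  apply/setIdP; split; rewrite ?groupM // morphM //; apply/eqP.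
  by rewrite /rmx map_mxM -!/(rmx _ _) -mulmxA ch !mulmxA cg.
suff /subsetP sIG : Ico \subset Group gG.
  by move=> g /sIG; rewrite inE => /andP[_ /eqP].
apply: Ico_gen; rewrite inE ?cyc5_Ico ?cyc3_Ico /=; apply/eqP.
  by apply: conf_invP axact_cyc5 _ => //; apply: conf_inv5.
by apply: conf_invP axact_cyc3 _ => //; apply: conf_inv3.
Qed.

Lemma confR_sq : confR *m confR = 5%:M.
Proof. by rewrite /confR -map_mxM conf_sq map_scalar_mx. Qed.

(** The orbit of the first axis meets every line, so an equivariant matrix is
    determined by its first row. *)
Lemma commutant_row0 (M : 'M[R]_6) :
    intertwines (B6_pullback R f) (B6_pullback R f) M -> row ord0 M = 0 ->
  M = 0.
Proof.
move=> cM; rewrite rowE -vecRE => x0.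
have step p g : g \in Ico -> vecR R p *m M = 0 -> vecR R (axact p (f g)) *m M = 0.
  by move=> Ig p0; rewrite vecR_axact -mulmxA [rmx _ _ *m _]cM // mulmxA p0 mul0mx.
have step5 k : (k < 12)%N -> vecR R (decode k) *m M = 0 ->
    vecR R (decode (nth 0%N img5 k)) *m M = 0.
  by move=> ltk /(step _ _ cyc5_Ico); rewrite axact_cyc5 decodeK.
have step3 k : (k < 12)%N -> vecR R (decode k) *m M = 0 ->
    vecR R (decode (nth 0%N img3 k)) *m M = 0.
  by move=> ltk /(step _ _ cyc3_Ico); rewrite axact_cyc3 decodeK.
(* Positions 0 -> 11 under [cyc3], then 11 -> 7 -> 8 -> 9 -> 10 under [cyc5]. *)
have k0 : vecR R (decode 0) *m M = 0.
  by rewrite (_ : decode 0 = (ord0, false)) //; apply: (codeK (ord0, false)).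
have k11 := step3 0%N isT k0; have k7 := step5 11%N isT k11.
have k8 := step5 7%N isT k7; have k9 := step5 8%N isT k8.
have k10 := step5 9%N isT k9.
have rows k : (k < 6)%N -> vecR R (decode k) *m M = 0.
  case: k => [_|k ltk]; first exact: k0.
  have -> : decode k.+1 = opp_axis (decode (k.+1 + 6)).
    apply: (can_inj codeK); rewrite decodeK; last lia.
    by rewrite /code /decode /= inordK ?ltn_mod //; lia.
  rewrite vecR_opp mulNmx; move: k ltk k7 k8 k9 k10 k11.
  case=> [|[|[|[|[|k]]]]] // _ e7 e8 e9 e10 e11;
    by rewrite ?(e7, e8, e9, e10, e11) oppr0.
apply/row_matrixP=> i; rewrite row0 rowE -vecRE.
by rewrite -[(i, false)]codeK rows // /code /= muln0 addn0.
Qed.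

(** The first row of an equivariant matrix is invariant under [cyc5], which fixes
    the first line and cycles through the five others; so it is determined by its
    first two entries, which the coefficients of 1 and [confR] can adjust. *)
Lemma commutant_conf (M : 'M[R]_6) :
    intertwines (B6_pullback R f) (B6_pullback R f) M ->
  exists a b, M = a%:M + b *: confR.
Proof.
move=> cM; pose x : axis := (ord0, false); pose y := decode 1.
pose a := bil M x x; pose b := bil M x y; exists a, b.
apply/eqP; rewrite -subr_eq0; apply/eqP; set M' := M - _.
have cM' : intertwines (B6_pullback R f) (B6_pullback R f) M'.
  move=> g Ig; rewrite /M' mulmxBr mulmxBl cM // mulmxDr mulmxDl scalar_mxC.
  by rewrite -scalemxAr -scalemxAl conf_commutes.
apply: (commutant_row0 cM').
have x5 : axact x (f cyc5) = x.
  by rewrite axact_cyc5; apply: (codeK x).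
have inv k : (k < 12)%N -> bil M' x (decode k) = 0 ->
    bil M' x (decode (nth 0%N img5 k)) = 0.
  move=> ltk xk; have [_ /(_ (cM' _ cyc5_Ico) x (decode k))] := bil_axact M' (f cyc5).
  by rewrite x5 axact_cyc5 decodeK // => ->.
have entry p : p.2 = false -> bil M' x p =
    M ord0 p.1 - (a * (p.1 == ord0)%:R + b * (conf_entry 0 p.1)%:~R).
  move=> p2; rewrite bilE p2 !expr0 !mul1r /M' !mxE [ord0 == _]eq_sym.
  by rewrite -[_ *+ (_ == _)]mulr_natr.
have k0 : bil M' x x = 0.
  rewrite entry // eqxx /conf_entry /= mulr1 mulr0 addr0 /a bilE.
  by rewrite !expr0 !mul1r subrr.
have k1 : bil M' x y = 0.
  have y1 : y.1 = 1%N :> nat by rewrite /= inordK.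
  rewrite entry // -val_eqE /= [X in conf_entry _ X]y1 /conf_entry /= inordK //.
  by rewrite mulr0 add0r mulr1 /b bilE !expr0 !mul1r subrr.
have k2 := inv 1%N isT k1; have k3 := inv 2%N isT k2; have k4 := inv 3%N isT k3.
have k5 := inv 4%N isT k4.
apply/rowP=> i; rewrite [LHS]mxE [RHS]mxE.
have -> : M' ord0 i = bil M' x (i, false) by rewrite bilE !expr0 !mul1r.
have -> : (i, false) = decode i by rewrite -[LHS]codeK /code muln0 addn0.
case: i => -[|[|[|[|[|[|i]]]]]] hi //.
by rewrite -[RHS]k0; congr bil; apply: (codeK x).
Qed.

Lemma cyc_rep_crystallographic : crystallographic R (f @* Ico)%G.
Proof.
pose s : R := Num.sqrt 5%:R.
have s2 : s ^+ 2 = 5%:R by rewrite sqr_sqrtr ?ler0n.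
have nzs : s != 0 by rewrite -sqrf_eq0 s2 pnatr_eq0.
pose S := s^-1 *: confR.
have SS : S *m S = 1%:M.
  rewrite /S -scalemxAl -scalemxAr confR_sq scale_scalar_mx scale_scalar_mx.
  by rewrite mulrA -expr2 exprVn s2 mulVf ?pnatr_eq0.
have trS : \tr S = 0.
  by rewrite mxtraceZ /confR trace_map_mx conf_tr rmorph0 mulr0.
have cS : intertwines (B6_pullback R f) (B6_pullback R f) S.
  by move=> g Ig; rewrite /S -scalemxAl -scalemxAr conf_commutes.
have chG : [pchar R]^'.-group Ico.
  by apply/pgroupP=> p _ _; rewrite inE /= pchar_num.
have [|T1 [T2 [irr1 irr2 nsim sim]]] := @involution_splits _ _ _ 3 _ _ isT chG SS trS cS.
  move=> M /commutant_conf[a [b ->]]; exists a, (b * s).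
  by rewrite /S scalerA mulfK.
exists f; split; first by apply/isomP; split; first exact: cyc_rep_inj.
by exists T1, T2.
Qed.

End Existence.

(** * One conjugacy class of 192 subgroups *)

Lemma crystallographic_conj (R : realType) (K : {group B6}) A :
  crystallographic R K -> crystallographic R (K :^ A)%G.
Proof.
case=> f [/isomP[injf imf] [T1 [T2 [pair sim]]]].
have fM : {in Ico &, {morph (fun g => f g ^ A)%g : g h / (g * h)%g}}.
  by move=> g h Ig Ih; rewrite morphM // conjMg.
pose f' := Morphism fM.
have fA : {in Ico, forall g, f' g = f g ^ A}%g by [].
exists f'; split.
  apply/isomP; split; last by rewrite (im_conj fA) imf.
  by apply/injmP=> g h Ig Ih /= /conjg_inj/(injmP injf); apply.
exists T1, T2; split=> //; apply: mx_rsim_trans sim.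
exists (rmx R A^-1%g)=> // [|g Ig].
  apply/row_freeP; exists (rmx R A).
  by rewrite /rmx -map_mxM -[_ *m _]/(B6val (A^-1 * A)%g) mulVg map_mx1.
rewrite /= -!map_mxM; congr map_mx.
by rewrite -[LHS]/(B6val (f g ^ A * A^-1)%g) conjgE -!mulgA mulgV mulg1.
Qed.

Theorem proposition4p1 (R : realType) :
  exists C : {set {group B6}},
    [/\ (forall H : {group B6}, H \in C <-> crystallographic R H),
        (exists K : {group B6}, C = [set (K :^ g)%G | g in [set: B6]])
      & #|C| = 192%N].
Proof.
have [f f_cyc] := exists_cyc_rep.
pose K := (f @* Ico)%G.
have crysK : crystallographic R K by apply: cyc_rep_crystallographic.
have sP := P5_syl.
have [h anti_h im_h] := crystallographic_antipodal crysK.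
have [x fx] := exists_fixed_axis anti_h sP.
exists [set (K :^ g)%G | g in [set: B6]]; split; last 1 first.
- have -> : [set (K :^ g)%G | g in [set: B6]] = orbit 'JG%act [set: B6] K.
    exact: eq_imset.
  rewrite card_orbit astab1JG setTI.
  have cN : #|'N(K)| = 240%N by rewrite -(card_normaliser anti_h fx) /= im_h.
  have := Lagrange (subsetT 'N(K)); rewrite cN card_B6.
  by rewrite -[(2 ^ 6 * 6`!)%N]/(240 * 192)%N => /eqP; rewrite eqn_pmul2l // => /eqP.
- move=> H; split=> [/imsetP[A _ ->] | ]; first exact: crystallographic_conj.
  case/crystallographic_antipodal=> h' anti_h' im_h'.
  have [x' fx'] := exists_fixed_axis anti_h' sP.
  have [A _ hA] := antipodal_conj anti_h anti_h' sP fx fx'.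
  apply/imsetP; exists A; rewrite ?inE //; apply: val_inj.
  by rewrite /= -im_h' (im_conj hA) im_h.
by exists K.
Qed.
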